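(* Let $n,m\geq 1$ and let $u=(u^1,\dots,u^m):\mathbb{R}^n\to\mathbb{R}^m$ be a smooth map satisfying on all of $\mathbb{R}^n$ the self-shrinking system in Euclidean space $$\sum_{i,j=1}^n g^{ij}u^{\alpha}_{ij}=-u^{\alpha}+x\cdot Du^{\alpha},\qquad \alpha=1,\dots,m,$$ where $(g^{ij})$ is the inverse of $g_{ij}=\delta_{ij}+\sum_{\alpha=1}^m u^\alpha_i u^\alpha_j$. Then $u$ has (at most) linear growth; in fact, for every $x\in\mathbb{R}^n$, $$|u(x)|^2\leq \left(\frac{2|x|^2}{3n}+1\right)\left(\sup_{|y|\leq 2\sqrt{3n}}|u(y)|^2+12n\right).$$
   Context: Notation: $u^\alpha_i=\partial u^\alpha/\partial x_i$, $u^\alpha_{ij}=\partial^2u^\alpha/\partial x_i\partial x_j$, $Du^\alpha=(u^\alpha_1,\dots,u^\alpha_n)$, $\cdot$ is the standard inner product on $\mathbb{R}^n$, and $|u(x)|^2=\sum_{\alpha=1}^m (u^\alpha(x))^2$. The system says that the graph $M=\{(x,u(x)):x\in\mathbb{R}^n\}\subset\mathbb{R}^{n+m}$ is a self-shrinker ($H=-X^N$) in Euclidean space. *)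

(* Defs.v *)
From HB Require Import structures.
From mathcomp Require Import all_boot all_order all_algebra.
From mathcomp Require Import all_classical all_reals all_analysis.

Set Implicit Arguments.
Unset Strict Implicit.
Unset Printing Implicit Defensive.

Import Order.TTheory GRing.Theory Num.Theory.
Import numFieldNormedType.Exports.

Local Open Scope classical_set_scope.
Local Open Scope ring_scope.

Definition dotprod (R : realType) (n : nat) (x y : 'rV[R]_n) : R :=
  \sum_(i < n) x 0 i * y 0 i.

(* The canonical norm `|x| on 'rV[R]_n is the sup norm, not this one; the two
   induce the same topology, hence the same continuity and differentiability. *)
Definition enorm (R : realType) (n : nat) (x : 'rV[R]_n) : R :=
  Num.sqrt (dotprod x x).

Definition pderiv (R : realType) (n : nat) (i : 'I_n) (f : 'rV[R]_n -> R) :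
    'rV[R]_n -> R :=
  fun x => 'D_(delta_mx 0 i) f x.

Definition gradient (R : realType) (n : nat) (f : 'rV[R]_n -> R)
    (x : 'rV[R]_n) : 'rV[R]_n :=
  \row_(i < n) pderiv i f x.

Definition iter_pderiv (R : realType) (n : nat) (s : seq 'I_n)
    (f : 'rV[R]_n -> R) : 'rV[R]_n -> R :=
  foldr (@pderiv R n) f s.

(* C^oo: partial derivatives of every order, in every order of
   differentiation, exist and are continuous on the whole space.  Existence is
   required explicitly because 'D_v f x is total. *)
Definition smooth (R : realType) (n : nat) (f : 'rV[R]_n -> R) : Prop :=
  forall s : seq 'I_n,
    continuous (iter_pderiv s f) /\
    (forall (i : 'I_n) (x : 'rV[R]_n),
       derivable (iter_pderiv s f) x (delta_mx 0 i)).

Definition component (R : realType) (n m : nat) (u : 'rV[R]_n -> 'rV[R]_m)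
    (a : 'I_m) : 'rV[R]_n -> R :=
  fun x => u x 0 a.

Definition smooth_map (R : realType) (n m : nat)
    (u : 'rV[R]_n -> 'rV[R]_m) : Prop :=
  forall a : 'I_m, smooth (component u a).

Definition graph_metric (R : realType) (n m : nat) (u : 'rV[R]_n -> 'rV[R]_m)
    (x : 'rV[R]_n) : 'M[R]_n :=
  \matrix_(i, j) ((i == j)%:R +
    \sum_(a < m) pderiv i (component u a) x * pderiv j (component u a) x).

(* graph_metric u x is the identity plus a positive semidefinite matrix, hence
   invertible, so invmx is its genuine inverse. *)
Definition graph_metric_inv (R : realType) (n m : nat)
    (u : 'rV[R]_n -> 'rV[R]_m) (x : 'rV[R]_n) : 'M[R]_n :=
  invmx (graph_metric u x).

Definition self_shrinking_system (R : realType) (n m : nat)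
    (u : 'rV[R]_n -> 'rV[R]_m) : Prop :=
  forall (a : 'I_m) (x : 'rV[R]_n),
    \sum_(i < n) \sum_(j < n)
       graph_metric_inv u x i j * pderiv i (pderiv j (component u a)) x
    = - component u a x + dotprod x (gradient (component u a) x).

Definition linear_growth (R : realType) (n m : nat)
    (u : 'rV[R]_n -> 'rV[R]_m) : Prop :=
  exists C : R, forall x : 'rV[R]_n, enorm (u x) <= C * (1 + enorm x).

(* Main.v *)
Require Import Defs.
From HB Require Import structures.
From mathcomp Require Import all_boot all_order all_algebra.
From mathcomp Require Import all_classical all_reals all_analysis.
From mathcomp Require Import ring lra.

Set Implicit Arguments.
Unset Strict Implicit.
Unset Printing Implicit Defensive.

Import Order.TTheory GRing.Theory Num.Theory.
Import numFieldNormedType.Exports.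

Local Open Scope classical_set_scope.
Local Open Scope ring_scope.

(* The maps [x |-> sqrt (- 2 t) u (x / sqrt (- 2 t))], [t < 0], have graphs
   moving by mean curvature.  Write [s = 1 / sqrt (- 2 t)].  A sphere of squared radius
   [r = 12 n] centred at [(0, c)], with [c] so high that the sphere starts away
   from the graph at [s = 1], shrinks while avoiding the graph: this is the
   minimum principle for [barrier] on the ball [|x|^2 <= r] and [1 <= s], where
   nothing is needed on the lateral boundary [|x|^2 = r] because the barrier is
   at least [r] there whatever [u] does.  Hence [u (s x) / s] stays bounded,
   uniformly in [s], for [|x|^2 = 3 n], and [s = |y| / sqrt (3 n)] gives the
   estimate at [y = s x]. *)

(** * Directional derivatives *)

Lemma is_derive_line (R : realType) (V : normedModType R) (f : V -> R)
    (p v : V) (t d : R) :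
  is_derive (p + t *: v) v f d -> is_derive t 1 (fun s => f (p + s *: v)) d.
Proof.
rewrite /derivable /derive.
have E : (fun h : R => h^-1 *: (((fun s => f (p + s *: v)) \o shift t)
            (h *: (1 : R)) - f (p + t *: v)))
    = (fun h => h^-1 *: ((f \o shift (p + t *: v)) (h *: v) - f (p + t *: v))).
  apply/funext => h /=; congr (_ *: (f _ - _)).
  by rewrite [_%:A]mulr1 scalerDl addrCA.
by move=> [fd dE]; split; rewrite /derivable /derive E.
Qed.

(** Substitute [h * k] for [h] in the difference quotient. The case [k = 0] is separate because
    [h * k] must stay nonzero. *)
Lemma is_derive_scale_dir (R : realType) (V : normedModType R) (f : V -> R)
    (x v : V) (k d : R) :
  is_derive x v f d -> is_derive x (k *: v) f (k * d).
Proof.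
have [-> _|k0 fd] := eqVneq k 0.
  by rewrite scale0r mul0r; exact: is_derive0.
suff H : (fun h => h^-1 *: ((f \o shift x) (h *: (k *: v)) - f x)) @ 0^'
    --> k * d.
  by apply: DeriveDef; [apply/cvg_ex; exists (k * d)|exact: cvg_lim].
have fd' : (fun h => h^-1 *: ((f \o shift x) (h *: v) - f x)) @ 0^' --> d.
  by case: fd => + <-.
have kh : (fun h : R => h * k) @ 0^' --> 0^'.
  move=> A [e /= e0 Ae]; exists (e / `|k|) => /=; first by rewrite divr_gt0 ?normr_gt0.
  move=> h /=; rewrite sub0r normrN ltr_pdivlMr ?normr_gt0// => he h0.
  by apply: Ae; rewrite /= ?sub0r ?normrN ?normrM ?mulf_neq0.
have L : k * ((h * k)^-1 *: ((f \o shift x) ((h * k) *: v) - f x)) @[h --> 0^']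
    --> k * d by apply: cvgMl_tmp; exact: (cvg_comp _ _ kh fd').
apply: cvg_trans L; apply: near_eq_cvg; near=> h => /=.
have h0 : h != 0 by near: h; exact: nbhs_dnbhs_neq.
by rewrite -[k * _]/(k *: _) !scalerA invfM mulrCA mulfV// mulr1.
Unshelve. all: by end_near. Qed.

(* Only one of the two directional derivatives needs to be continuous: the
   increment along [b] is handled by the mean value theorem. *)
Lemma is_derive_add_dir (R : realType) (V : normedModType R) (f : V -> R)
    (x a b : V) :
  derivable f x a -> (forall y, derivable f y b) -> {for x, continuous ('D_b f)} ->
  is_derive x (a + b) f ('D_a f x + 'D_b f x).
Proof.
move=> fa fb cb.
suff H : (fun h => h^-1 *: ((f \o shift x) (h *: (a + b)) - f x)) @ 0^'
    --> 'D_a f x + 'D_b f x.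
  by apply: DeriveDef; [apply/cvg_ex; eexists; exact: H|exact: cvg_lim].
(* The increment is split at [x + h *: a]: [g] covers the move along [a] from [x], [k] the move
   along [b] from there. *)
pose g h := h^-1 *: ((f \o shift x) (h *: a) - f x).
pose k h := h^-1 *: (f (h *: b + (h *: a + x)) - f (h *: a + x)).
have -> : (fun h => h^-1 *: ((f \o shift x) (h *: (a + b)) - f x)) = g \+ k.
  apply/funext => h; rewrite /g /k /= -scalerDr; congr (_ *: _).
  by rewrite [RHS]addrC subrKA scalerDr addrCA addrA.
apply: cvgD; first exact: fa.
apply/cvgrPdist_lt => e e0.
have := cb; move=> /cvgrPdist_lt/(_ e e0).
move=> /nbhs_normP[d /= d0 Hd].
near=> h.
have h0 : h != 0 by near: h; exact: nbhs_dnbhs_neq.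
(* This bound keeps every intermediate point of the mean value theorem within [d] of [x]. *)
have hd : `|h| * (`|a| + `|b| + 1) < d.
  rewrite -ltr_pdivlMr ?ltr_wpDl// ?addr_ge0//.
  near: h; apply: dnbhs0_lt; rewrite divr_gt0// ltr_wpDl// ?addr_ge0//.
set y := h *: a + x.
have [||s] := @MVT_segment R (fun s => f (y + s *: (h *: b)))
    (fun s => h * 'D_b f (y + s *: (h *: b))) 0 1 ler01.
- move=> s _; apply: is_derive_line; apply: is_derive_scale_dir.
  exact/derivableP.
- apply: derivable_within_continuous => s _.
  have [] // := @is_derive_line R V f y (h *: b) s (h * 'D_b f (y + s *: (h *: b))).
  by apply: is_derive_scale_dir; exact/derivableP.
rewrite in_itv /= => /andP[s0 s1].
rewrite scale1r scale0r addr0 subr0 mulr1 => E.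
rewrite /k (addrC (h *: b)) E /GRing.scale /= mulKf//.
apply: Hd => /=.
rewrite /y addrAC opprD addrCA subrr addr0 normrN.
apply: le_lt_trans hd; rewrite (le_trans (ler_normD _ _))// !normrZ.
rewrite (ger0_norm s0) [leRHS]mulrDr mulr1 mulrDr.
rewrite -[leLHS]addr0 lerD// lerD// ler_piMl// mulr_ge0//.
Unshelve. all: by end_near. Qed.

(** * First and second derivative tests in one variable *)

Lemma is_derive_pos_near (R : realType) (f : R -> R) (x d : R) :
  is_derive x 1 f d -> 0 < d ->
  \forall z \near x, (z < x -> f z < f x) /\ (x < z -> f x < f z).
Proof.
move=> /is_derive1_caratheodory[g [fE cg gx]] d0.
have : \forall z \near x, 0 < g z.
  by move: d0; rewrite -gx; exact: cvgr_gt cg _.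
apply: filterS => z gz; split => zx.
  by rewrite -subr_lt0 fE pmulr_rlt0// subr_lt0.
by rewrite -subr_gt0 fE pmulr_rgt0// subr_gt0.
Qed.

(** A positive derivative would give smaller values just to the left of [x]. One side is enough for
    a minimum in time, which may occur at the last time considered. *)
Lemma left_min_derive_le0 (R : realType) (f : R -> R) (x d a : R) :
  is_derive x 1 f d -> a < x -> (forall z, a <= z <= x -> f x <= f z) ->
  d <= 0.
Proof.
move=> fd ax fm; rewrite leNgt; apply/negP => d0.
have /nbhs_normP[e /= e0 He] := is_derive_pos_near fd d0.
pose z := Num.max a (x - e / 2).
have zx : z < x by rewrite /z gt_max ax/= ltrBlDr ltrDl divr_gt0.
have := He z; case.
  rewrite /= gtr0_norm ?subr_gt0// ltrBlDr addrC -ltrBlDr /z lt_max.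
  by apply/orP; right; rewrite ltrD2l ltrN2 ltr_pdivrMr// ltr_pMr// ltr1n.
move=> /(_ zx); rewrite ltNge fm//.
by rewrite (ltW zx) /z le_max lexx.
Qed.

(** At the minimum [df] vanishes. If [d] were negative, [df] would be negative just to the right of
    [x], and the mean value theorem would make [f] drop below its minimum. *)
Lemma min_second_derive_ge0 (R : realType) (f df : R -> R) (x d e : R) :
  0 < e -> (forall t : R, is_derive t (1 : R) f (df t)) -> is_derive x 1 df d ->
  (forall t, `|t - x| < e -> f x <= f t) -> 0 <= d.
Proof.
move=> e0 fd dfd fm; rewrite leNgt; apply/negP => d0.
have df0 : df x = 0.
  rewrite -(@derive_val _ _ _ _ _ _ _ (fd x)).
  apply: derive_val; apply: (@derive1_at_min R f (x - e) (x + e)).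
  - by rewrite lerD2l ge0_cp// ltW.
  - by move=> t _; case: (fd t).
  - by rewrite in_itv /= ltrBlDr !ltrDl e0.
  - by move=> t; rewrite in_itv /= => te; apply: fm; rewrite ltr_distl.
have /nbhs_normP[r /= r0 Hr] : \forall z \near x, x < z -> df z < 0.
  have nd : is_derive x 1 (- df) (- d) by exact: is_deriveN.
  have := is_derive_pos_near nd; rewrite oppr_gt0 => /(_ d0).
  apply: filterS => z [_ H] /H; rewrite /= -[(- df) x]/(- df x) df0.
  by rewrite -[(- df) z]/(- df z) oppr0 oppr_gt0.
pose z := x + Num.min e r / 2.
have mp : 0 < Num.min e r by rewrite lt_min e0.
have xz : x < z by rewrite ltrDl divr_gt0.
have mh : Num.min e r / 2 < Num.min e r.
  by rewrite ltr_pdivrMr// ltr_pMr// ltr1n.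
have [|c] := @MVT R f df x z xz.
  by apply: derivable_within_continuous => t _; have [] := fd t.
rewrite in_itv /= => /andP[xc cz] E.
have : f z - f x < 0.
  rewrite E nmulr_rlt0 ?subr_gt0//; apply: Hr => //=.
  rewrite ltr0_norm ?subr_lt0// opprB ltrBlDl.
  by rewrite (lt_le_trans cz)// lerD2l (le_trans (ltW mh))// ge_min lexx orbT.
apply/negP; rewrite -leNgt subr_ge0; apply: fm.
rewrite /z addrC addKr gtr0_norm ?divr_gt0//.
by rewrite (lt_le_trans mh)// ge_min lexx.
Qed.

(** * Differentiation rules and smooth functions *)

Lemma is_derive_bigsum (R : realType) (V : normedModType R) (k : nat)
    (h : 'I_k -> V -> R) (dh : 'I_k -> R) (x v : V) :
  (forall i, is_derive x v (h i) (dh i)) ->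
  is_derive x v (fun y => \sum_(i < k) h i y) (\sum_(i < k) dh i).
Proof.
move=> hd.
have -> : (fun y => \sum_(i < k) h i y) = \sum_(i < k) h i.
  by apply/funext => y; rewrite fct_sumE.
exact: is_derive_sum.
Qed.

Lemma is_derive_mul (R : realType) (f g : R -> R) (x a b : R) :
  is_derive x 1 f a -> is_derive x 1 g b ->
  is_derive x 1 (fun y => f y * g y) (a * g x + f x * b).
Proof.
move=> fa gb; apply: is_derive_eq.
by rewrite /GRing.scale /= addrC mulrC.
Qed.

Lemma is_derive_sqr_sub (R : realType) (f : R -> R) (x a c : R) :
  is_derive x 1 f a -> is_derive x 1 (fun y => (f y - c) ^+ 2) (2 * ((f x - c) * a)).
Proof.
move=> fa; have fc : is_derive x 1 (fun y => f y - c) a.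
  by apply: (is_derive_eq (is_deriveB fa (is_derive_cst c x 1))); rewrite subr0.
apply: (is_derive_eq (is_derive_mul fc fc)).
by rewrite mulrC -mulr2n mulr_natl.
Qed.

Lemma is_derive_affine (R : realType) (a b t : R) :
  is_derive t (1 : R) (fun s => a + s * b) b.
Proof.
have H : is_derive t 1 (fun s : R => s * b) b.
  apply: (is_derive_eq (is_derive_mul (is_derive_id t 1) (is_derive_cst b t 1))).
  by rewrite mulr0 addr0 mul1r.
by apply: (is_derive_eq (is_deriveD (is_derive_cst a t 1) H)); rewrite add0r.
Qed.

Lemma smooth_pderiv (R : realType) (n : nat) (f : 'rV[R]_n -> R) (i : 'I_n) :
  smooth f -> smooth (pderiv i f).
Proof.
(* [foldr] applies the last entry of the list first, so [pderiv i] goes to the end. *)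
move=> fs s; have := fs (rcons s i).
by rewrite /iter_pderiv foldr_rcons.
Qed.

(** Smoothness speaks of coordinate directions only. The vector [v] is assembled one coordinate at a
    time with [is_derive_add_dir], the continuity of each partial derivative supplying its
    hypothesis. *)
Lemma smooth_is_derive (R : realType) (n : nat) (f : 'rV[R]_n -> R)
    (x v : 'rV[R]_n) :
  smooth f -> is_derive x v f (dotprod v (gradient f x)).
Proof.
move=> fs.
have fe i y : is_derive y (v 0 i *: delta_mx 0 i) f (v 0 i * pderiv i f y).
  apply: is_derive_scale_dir; apply/derivableP.
  by have [_] := fs [::]; apply.
have -> : dotprod v (gradient f x) = \sum_(i < n) v 0 i * pderiv i f x.
  by apply: eq_bigr => i _; rewrite mxE.
rewrite {1}(row_sum_delta v).
elim: (index_enum _) => [|i r IH].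
  by rewrite !big_nil; exact: is_derive0.
rewrite !big_cons (addrC (v 0 i *: _)) (addrC (v 0 i * _)).
have fr : derivable f x (\sum_(j <- r) v 0 j *: delta_mx 0 j) by case: IH.
have fi y : derivable f y (v 0 i *: delta_mx 0 i) by case: (fe i y).
have Ei : 'D_(v 0 i *: delta_mx 0 i) f = fun y => v 0 i * pderiv i f y.
  by apply/funext => y; case: (fe i y).
apply: is_derive_eq.
  apply: (is_derive_add_dir fr fi); rewrite Ei.
  have [c _] := fs [:: i].
  exact: (@cvgMl_tmp _ _ (nbhs x) _ _ (v 0 i) _ (c x)).
by congr (_ + _); [case: IH|case: (fe i x)].
Qed.

(** * Linear algebra of the inverse metric *)

Lemma dotprod_ge0 (R : realType) (n : nat) (x : 'rV[R]_n) : 0 <= dotprod x x.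
Proof. by apply: sumr_ge0 => i _; rewrite -expr2 sqr_ge0. Qed.

Lemma mulmx_trE (R : realType) (n : nat) (x y : 'rV[R]_n) :
  (x *m y^T) 0 0 = dotprod x y.
Proof. by rewrite mxE; apply: eq_bigr => i _; rewrite mxE. Qed.

Lemma dotprod_eq0 (R : realType) (n : nat) (x : 'rV[R]_n) :
  dotprod x x = 0 -> x = 0.
Proof.
move=> x0; apply/rowP => i; rewrite mxE.
have /psumr_eq0P : forall i : 'I_n, true -> 0 <= x 0 i * x 0 i.
  by move=> j _; rewrite -expr2 sqr_ge0.
by move=> /(_ x0 i isT) /eqP; rewrite mulf_eq0 orbb => /eqP.
Qed.

(** If [v] is in the kernel, pairing with [v] gives $|v|^2 + |vA|^2 = 0$, hence $v = 0$. *)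
Lemma unitmx_gram (R : realType) (n m : nat) (A : 'M[R]_(n, m)) :
  1%:M + A *m A^T \in unitmx.
Proof.
rewrite -row_free_unit; apply: inj_row_free => v /(congr1 (mulmx^~ v^T)).
rewrite mul0mx mulmxDr mulmx1 mulmxDl mulmxA -mulmxA -trmx_mul.
move=> /matrixP/(_ 0 0); rewrite mxE !mulmx_trE [RHS]mxE => /eqP.
rewrite paddr_eq0 ?dotprod_ge0// => /andP[/eqP + _].
exact: dotprod_eq0.
Qed.

(* With [G] the inverse of [1 + A A^T], one has [G = G G^T + (G A) (G A)^T], so
   [\tr (G H)] is a sum of values of the quadratic form of [H]. *)
Lemma gram_inv_trace_ge0 (R : realType) (n m : nat) (A : 'M[R]_(n, m))
    (H : 'I_n -> 'I_n -> R) :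
  (forall v : 'rV[R]_n, 0 <= \sum_i \sum_j v 0 i * v 0 j * H i j) ->
  0 <= \sum_i \sum_j invmx (1%:M + A *m A^T) i j * H i j.
Proof.
move=> Hpos; set g := 1%:M + _; set G := invmx g.
have gT : g^T = g by rewrite /g linearD /= trmx1 trmx_mul trmxK.
have GT : G^T = G by rewrite /G trmx_inv gT.
(* Factor the right side as [G *m g *m G^T] and cancel [g] against [G^T = G]. *)
have GE : G = G *m G^T + (G *m A) *m (G *m A)^T.
  rewrite trmx_mul -mulmxA (mulmxA A) -mulmxDr -{1}[G^T]mul1mx -mulmxDl -/g.
  by rewrite GT mulmxV ?mulmx1// unitmx_gram.
(* [B *m B^T] is the sum of the rank-one matrices of the columns of [B]; each contributes one value
   of the quadratic form. *)
have sumE k (B : 'M[R]_(n, k)) :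
    0 <= \sum_i \sum_j (B *m B^T) i j * H i j.
  have -> : \sum_i \sum_j (B *m B^T) i j * H i j
      = \sum_l \sum_i \sum_j (row l B^T) 0 i * (row l B^T) 0 j * H i j.
    rewrite [RHS]exchange_big; apply: eq_bigr => i _ /=.
    rewrite [RHS]exchange_big; apply: eq_bigr => j _ /=.
    rewrite mxE mulr_suml; apply: eq_bigr => l _.
    by rewrite !mxE.
  by apply: sumr_ge0 => l _; exact: Hpos.
have -> : \sum_i \sum_j G i j * H i j
    = \sum_i \sum_j (G *m G^T) i j * H i j
      + \sum_i \sum_j ((G *m A) *m (G *m A)^T) i j * H i j.
  rewrite -big_split; apply: eq_bigr => i _ /=.
  rewrite -big_split; apply: eq_bigr => j _ /=.
  by rewrite -mulrDl {1}GE mxE.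
by rewrite addr_ge0.
Qed.

(** * Squared distance to the graph and its minima in space *)

(** Rows are indexed by the variables, the transpose of the usual convention, so that the metric
    reads $1 + JJ^T$. *)
Definition jacobian (R : realType) (n m : nat) (u : 'rV[R]_n -> 'rV[R]_m)
    (x : 'rV[R]_n) : 'M[R]_(n, m) :=
  \matrix_(i, a) pderiv i (component u a) x.

Lemma graph_metricE (R : realType) (n m : nat) (u : 'rV[R]_n -> 'rV[R]_m)
    (x : 'rV[R]_n) :
  graph_metric u x = 1%:M + jacobian u x *m (jacobian u x)^T.
Proof.
apply/matrixP => i j; rewrite !mxE; congr (_ + _).
by apply: eq_bigr => a _; rewrite !mxE.
Qed.

(** Squared Euclidean distance in $\mathbb{R}^{n+m}$ from the centre $(0,c)$ to the graph point
    $(y,u(y))$. *)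
Definition dist2_graph (R : realType) (n m : nat) (u : 'rV[R]_n -> 'rV[R]_m)
    (c : 'rV[R]_m) (y : 'rV[R]_n) : R :=
  dotprod y y + dotprod (u y - c) (u y - c).

(** Second derivative test along the line through [p] in direction [v]. Half the Hessian of the
    squared distance is $g_{ij} + (u-c)\cdot u_{ij}$, the products of first derivatives being
    absorbed in the metric. *)
Lemma dist2_graph_hessian (R : realType) (n m : nat) (u : 'rV[R]_n -> 'rV[R]_m)
    (c : 'rV[R]_m) (p v : 'rV[R]_n) (e : R) :
  smooth_map u -> 0 < e ->
  (forall t : R, `|t| < e -> dist2_graph u c p <= dist2_graph u c (p + t *: v)) ->
  0 <= \sum_i \sum_j v 0 i * v 0 j * (graph_metric u p i j +
    \sum_a (u p 0 a - c 0 a) * pderiv i (pderiv j (component u a)) p).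
Proof.
move=> us e0 pmin.
(* The [- 0] gives both sums the shape treated by [is_derive_sqr_sub]. *)
pose f t := \sum_(i < n) (p 0 i + t * v 0 i - 0) ^+ 2
  + \sum_(a < m) (component u a (p + t *: v) - c 0 a) ^+ 2.
pose df t := 2 * (\sum_(i < n) (p 0 i + t * v 0 i) * v 0 i
  + \sum_(a < m) (component u a (p + t *: v) - c 0 a)
      * dotprod v (gradient (component u a) (p + t *: v))).
have fE t : dist2_graph u c (p + t *: v) = f t.
  rewrite /dist2_graph /f /dotprod; congr (_ + _).
    by apply: eq_bigr => i _; rewrite !mxE subr0 expr2.
  by apply: eq_bigr => a _; rewrite !mxE expr2.
have dcomp a (t : R) : is_derive t 1 (fun s : R => component u a (p + s *: v))
    (dotprod v (gradient (component u a) (p + t *: v))).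
  by apply: is_derive_line; apply: smooth_is_derive; exact: us.
have fd (t : R) : is_derive t (1 : R) f (df t).
  have H1 : is_derive t 1 (fun s : R => \sum_(i < n) (p 0 i + s * v 0 i - 0) ^+ 2)
      (\sum_(i < n) 2 * ((p 0 i + t * v 0 i - 0) * v 0 i)).
    apply: is_derive_bigsum => i; apply: is_derive_sqr_sub.
    exact: is_derive_affine.
  have H2 := is_derive_bigsum (fun a => is_derive_sqr_sub (c 0 a) (dcomp a t)).
  apply: (is_derive_eq (is_deriveD H1 H2)).
  rewrite -!mulr_sumr -mulrDr; congr (_ * (_ + _)).
  by apply: eq_bigr => i _; rewrite subr0.
(* Half the second derivative at [t = 0], in the form the product rule delivers it. *)
pose Q : R := \sum_(i < n) v 0 i * v 0 i + \sum_(a < m)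
  (dotprod v (gradient (component u a) p) * dotprod v (gradient (component u a) p)
   + (u p 0 a - c 0 a) *
     \sum_(j < n) v 0 j * dotprod v (gradient (pderiv j (component u a)) p)).
have dfd : is_derive (0 : R) 1 df (2 * Q).
  have dgrad a : is_derive (0 : R) 1
      (fun s : R => dotprod v (gradient (component u a) (p + s *: v)))
      (\sum_(j < n) v 0 j * dotprod v (gradient (pderiv j (component u a)) p)).
    have -> : (fun s : R => dotprod v (gradient (component u a) (p + s *: v)))
        = fun s : R => \sum_(j < n) v 0 j * pderiv j (component u a) (p + s *: v).
      by apply/funext => s; apply: eq_bigr => j _; rewrite mxE.
    apply: is_derive_bigsum => j.
    apply: (is_deriveZ _ (f := fun s : R => pderiv j (component u a) (p + s *: v))).
    apply: is_derive_line; rewrite scale0r addr0.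
    by apply: smooth_is_derive; apply: smooth_pderiv; exact: us.
  apply: (is_deriveZ 2 (f := fun t => _ + _)).
  apply: is_deriveD.
    apply: is_derive_bigsum => i.
    apply: (is_derive_eq (is_derive_mul (is_derive_affine _ _ _) (is_derive_cst _ _ _))).
    by rewrite mulr0 addr0.
  apply: is_derive_bigsum => a.
  have dc : is_derive (0 : R) 1 (fun s : R => component u a (p + s *: v) - c 0 a)
      (dotprod v (gradient (component u a) (p + 0 *: v))).
    apply: (is_derive_eq (is_deriveB (dcomp a 0) (is_derive_cst (c 0 a) _ _))).
    by rewrite subr0.
  apply: (is_derive_eq (is_derive_mul dc (dgrad a))).
  by rewrite scale0r addr0.
have : 0 <= 2 * Q.
  apply: (min_second_derive_ge0 e0 fd dfd) => t; rewrite subr0 => te.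
  by rewrite -!fE scale0r addr0; exact: pmin.
rewrite pmulr_rge0// => Q0; apply: (le_trans Q0); rewrite le_eqVlt; apply/orP; left.
apply/eqP.
have -> : \sum_i \sum_j v 0 i * v 0 j * (graph_metric u p i j +
      \sum_a (u p 0 a - c 0 a) * pderiv i (pderiv j (component u a)) p)
   = \sum_i \sum_j v 0 i * v 0 j * (i == j)%:R
   + \sum_a (\sum_i \sum_j v 0 i * v 0 j *
        (pderiv i (component u a) p * pderiv j (component u a) p)
     + \sum_i \sum_j v 0 i * v 0 j *
        ((u p 0 a - c 0 a) * pderiv i (pderiv j (component u a)) p)).
  rewrite [X in _ = _ + X]big_split /=.
  rewrite [X in _ = _ + (X + _)]exchange_big [X in _ = _ + (_ + X)]exchange_big.
  rewrite -!big_split /=; apply: eq_bigr => i _.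
  rewrite [X in _ = _ + (X + _)]exchange_big [X in _ = _ + (_ + X)]exchange_big /=.
  rewrite -!big_split /=; apply: eq_bigr => j _.
  by rewrite mxE !mulrDr !mulr_sumr addrA.
congr (_ + _).
  apply: eq_bigr => i _; rewrite (bigD1 i)//= eqxx mulr1 big1 ?addr0// => j ji.
  by rewrite eq_sym (negbTE ji) mulr0.
apply: eq_bigr => a _; congr (_ + _).
  rewrite /dotprod mulr_suml; apply: eq_bigr => i _.
  rewrite mulr_sumr; apply: eq_bigr => j _; rewrite !mxE; ring.
rewrite mulr_sumr exchange_big; apply: eq_bigr => j _ /=.
rewrite /dotprod !mulr_sumr; apply: eq_bigr => i _; rewrite !mxE; ring.
Qed.

(** Contract the nonnegative half Hessian with $g^{ij}$: the metric contributes its trace $n$, and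
    the system replaces $g^{ij}u_{ij}$ by $x\cdot Du-u$. *)
Lemma shrinker_spatial_min (R : realType) (n m : nat) (u : 'rV[R]_n -> 'rV[R]_m)
    (c : 'rV[R]_m) (p : 'rV[R]_n) :
  smooth_map u -> self_shrinking_system u ->
  (forall v : 'rV[R]_n, exists2 e : R, 0 < e & forall t : R, `|t| < e ->
     dist2_graph u c p <= dist2_graph u c (p + t *: v)) ->
  0 <= n%:R + \sum_a (u p 0 a - c 0 a) *
    (dotprod p (gradient (component u a) p) - component u a p).
Proof.
move=> us usys pmin.
have Hpos (v : 'rV[R]_n) : 0 <= \sum_i \sum_j v 0 i * v 0 j * (graph_metric u p i j +
    \sum_a (u p 0 a - c 0 a) * pderiv i (pderiv j (component u a)) p).
  by have [e e0] := pmin v; exact: dist2_graph_hessian.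
have := gram_inv_trace_ge0 (jacobian u p) Hpos; rewrite -graph_metricE.
congr (_ <= _).
have gU : graph_metric u p \in unitmx by rewrite graph_metricE unitmx_gram.
transitivity (\sum_i \sum_j graph_metric_inv u p i j * graph_metric u p j i
  + \sum_a (u p 0 a - c 0 a) * (\sum_i \sum_j graph_metric_inv u p i j *
      pderiv i (pderiv j (component u a)) p)).
  rewrite [X in _ + X](eq_bigr (fun a => \sum_i \sum_j (u p 0 a - c 0 a) *
    (graph_metric_inv u p i j * pderiv i (pderiv j (component u a)) p))); last first.
    by move=> a _; rewrite mulr_sumr; apply: eq_bigr => i _; rewrite mulr_sumr.
  rewrite [X in _ + X]exchange_big -big_split /=; apply: eq_bigr => i _.
  rewrite [X in _ + X]exchange_big -big_split /=; apply: eq_bigr => j _.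
  rewrite -[invmx _]/(graph_metric_inv u p) mulrDr mulr_sumr; congr (_ + _).
    congr (_ * _); rewrite !mxE eq_sym; congr (_ + _).
    by apply: eq_bigr => a _; rewrite mulrC.
  by apply: eq_bigr => a _; rewrite mulrCA.
congr (_ + _).
  transitivity (\tr (invmx (graph_metric u p) *m graph_metric u p)).
    by apply: eq_bigr => i _; rewrite mxE.
  by rewrite mulVmx// mxtrace1.
by apply: eq_bigr => a _; rewrite usys [in LHS](addrC (- _)).
Qed.

(** * Continuity and compactness *)

Lemma cvg_bigsum (R : realType) (T : Type) (F : set_system T) {FF : Filter F}
    (k : nat) (h : 'I_k -> T -> R) (l : 'I_k -> R) :
  (forall i, h i x @[x --> F] --> l i) ->
  (\sum_(i < k) h i x) @[x --> F] --> \sum_(i < k) l i.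
Proof.
move=> hl; elim: (index_enum _) => [|i r IH].
  rewrite big_nil; under eq_fun do rewrite big_nil; exact: cvg_cst.
rewrite big_cons; under eq_fun do rewrite big_cons; exact: cvgD.
Qed.

Lemma dotprod_self_continuous (R : realType) (n : nat) :
  continuous (fun x : 'rV[R]_n => dotprod x x).
Proof.
move=> x; apply: (@cvg_bigsum _ _ (nbhs x)) => i.
by apply: (@cvgM _ _ (nbhs x)); exact: coord_continuous.
Qed.

Lemma compact_euclidean_ball (R : realType) (n : nat) (r : R) :
  compact [set x : 'rV[R]_n | dotprod x x <= r].
Proof.
apply: bounded_closed_compact.
  (* The norm here is the sup norm; [r + 1] dominates each coordinate, since $t^2\leq r$ implies
     $t\leq r+1$. *)
  exists (r + 1); split=> [|M rM x /= xr]; first exact: num_real.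
  have r0 : 0 <= r by exact: le_trans (dotprod_ge0 x) xr.
  rewrite /Num.norm /= mx_normrE; apply: bigmax_le => [|[i j] _ /=].
    by rewrite (le_trans _ (ltW rM))// addr_ge0.
  rewrite ord1; apply: le_trans (ltW rM).
  have xj : `|x 0 j| ^+ 2 <= r.
    apply: le_trans xr; rewrite /dotprod (bigD1 j)//= real_normK ?num_real//.
    by rewrite expr2 lerDl; apply: sumr_ge0 => k _; rewrite -expr2 sqr_ge0.
  have := normr_ge0 (x 0 j); nra.
apply: (@closed_comp _ _ (fun x : 'rV[R]_n => dotprod x x) [set t | t <= r]).
  by move=> x _; exact: dotprod_self_continuous.
exact: closed_le.
Qed.

(** * The barrier and its minimum principle *)

(* The shrinking sphere corresponds to the term [n (1 - s^-2)]; doubling it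
   turns the minimum principle into a strict one. *)
Definition barrier (R : realType) (n m : nat) (u : 'rV[R]_n -> 'rV[R]_m)
    (c : 'rV[R]_m) (x : 'rV[R]_n) (s : R) : R :=
  dotprod x x + \sum_(a < m) (component u a (s *: x) * s^-1 - c 0 a) ^+ 2
  + 2 * n%:R * (1 - s^-1 ^+ 2).

(** At fixed [s] the barrier is, up to a positive factor and a constant, a squared distance to the
    unscaled graph, so its minima in space fall under [shrinker_spatial_min]. *)
Lemma barrier_dist2_graph (R : realType) (n m : nat) (u : 'rV[R]_n -> 'rV[R]_m)
    (c : 'rV[R]_m) (x : 'rV[R]_n) (s : R) :
  s != 0 ->
  s ^+ 2 * barrier u c x s
    = dist2_graph u (s *: c) (s *: x) + 2 * n%:R * (s ^+ 2 - 1).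
Proof.
move=> s0; rewrite /barrier /dist2_graph /dotprod !mulrDr !mulr_sumr.
congr (_ + _ + _); last by field.
- by apply: eq_bigr => i _; rewrite !mxE; ring.
- by apply: eq_bigr => a _; rewrite !mxE /component; field.
Qed.

Lemma barrier_continuous (R : realType) (n m : nat) (u : 'rV[R]_n -> 'rV[R]_m)
    (c : 'rV[R]_m) (x : 'rV[R]_n) (s : R) :
  smooth_map u -> s != 0 ->
  {for (x, s), continuous (fun z : 'rV[R]_n * R => barrier u c z.1 z.2)}.
Proof.
move=> us s0; pose z0 := (x, s).
have c1 : z.1 @[z --> nbhs z0] --> x by exact: cvg_fst.
have c2 : z.2 @[z --> nbhs z0] --> s by exact: cvg_snd.
have cV : z.2^-1 @[z --> nbhs z0] --> s^-1 by exact: cvgV.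
have cZ : (z.2 *: z.1) @[z --> nbhs z0] --> s *: x by exact: cvgZ.
have cD : dotprod z.1 z.1 @[z --> nbhs z0] --> dotprod x x.
  exact: (cvg_comp _ _ c1 (@dotprod_self_continuous R n x)).
have cU a : component u a (z.2 *: z.1) @[z --> nbhs z0]
    --> component u a (s *: x).
  have [cu _] := us a [::]; exact: (cvg_comp _ _ cZ (cu (s *: x))).
have cS : (\sum_(a < m) (component u a (z.2 *: z.1) * z.2^-1 - c 0 a) ^+ 2)
    @[z --> nbhs z0]
    --> \sum_(a < m) (component u a (s *: x) * s^-1 - c 0 a) ^+ 2.
  apply: cvg_bigsum => a.
  have ca : (component u a (z.2 *: z.1) * z.2^-1 - c 0 a) @[z --> nbhs z0]
      --> component u a (s *: x) * s^-1 - c 0 a.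
    by apply: cvgB; [exact: (cvgM (cU a) cV)|exact: cvg_cst].
  exact: (cvgM ca ca).
have cN : (2 * n%:R * (1 - z.2^-1 ^+ 2)) @[z --> nbhs z0]
    --> 2 * n%:R * (1 - s^-1 ^+ 2).
  by apply: cvgMl_tmp; apply: cvgB; [exact: cvg_cst|exact: (cvgM cV cV)].
exact: (cvgD (cvgD cD cS) cN).
Qed.

(** The form is chosen for comparison: for [s > 0] the prefactor is positive, and the sum is the one
    of [shrinker_spatial_min] at the point [s *: x] with centre [s *: c]. *)
Lemma barrier_is_derive (R : realType) (n m : nat) (u : 'rV[R]_n -> 'rV[R]_m)
    (c : 'rV[R]_m) (x : 'rV[R]_n) (s : R) :
  smooth_map u -> s != 0 ->
  is_derive s (1 : R) (barrier u c x)
    (2 / s ^+ 3 *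
      (\sum_a (u (s *: x) 0 a - s * c 0 a) *
          (dotprod (s *: x) (gradient (component u a) (s *: x))
            - component u a (s *: x))
       + 2 * n%:R)).
Proof.
move=> us s0.
have dV : is_derive s (1 : R) (fun t : R => t^-1) (- s ^- 2).
  apply: (is_derive_eq (is_deriveV (f := id) s0 (is_derive_id s 1))).
  by rewrite /GRing.scale /= mulr1.
have du a : is_derive s (1 : R) (fun t : R => component u a (t *: x))
    (dotprod x (gradient (component u a) (s *: x))).
  have -> : (fun t : R => component u a (t *: x))
      = (fun t : R => component u a (0 + t *: x)).
    by apply/funext => t; rewrite add0r.
  by apply: is_derive_line; rewrite add0r; apply: smooth_is_derive; exact: us.
have H2 := is_derive_bigsum (fun a =>
  is_derive_sqr_sub (c 0 a) (is_derive_mul (du a) dV)).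
have H3 : is_derive s (1 : R) (fun t : R => 2 * n%:R * (1 - t^-1 ^+ 2))
    (2 * n%:R * (0 - (- s ^- 2 * s^-1 + s^-1 * - s ^- 2))).
  exact: (is_deriveZ _ (is_deriveB (is_derive_cst (1 : R) _ _) (is_derive_mul dV dV))).
apply: (is_derive_eq (is_deriveD
  (is_deriveD (is_derive_cst (dotprod x x) _ _) H2) H3)).
rewrite add0r [RHS]mulrDr [X in _ = X + _]mulr_sumr; congr (_ + _); last by field.
apply: eq_bigr => a _; rewrite /dotprod.
have -> : \sum_i (s *: x) 0 i * gradient (component u a) (s *: x) 0 i
    = s * \sum_i x 0 i * gradient (component u a) (s *: x) 0 i.
  by rewrite mulr_sumr; apply: eq_bigr => i _; rewrite !mxE mulrA.
by rewrite /component; field.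
Qed.

(** A minimum below [r] over the ball and the interval from [1] to [s] is interior in space and
    later than [1]. With $\Sigma$ the common sum, time gives $\Sigma+2n\leq 0$ and space gives
    $n+\Sigma\geq 0$, impossible for $n>0$. *)
Lemma shrinker_avoids_sphere (R : realType) (n m : nat)
    (u : 'rV[R]_n -> 'rV[R]_m) (c : 'rV[R]_m) (r : R) (x : 'rV[R]_n) (s : R) :
  (0 < n)%N -> smooth_map u -> self_shrinking_system u ->
  (forall y, dotprod y y <= r -> r <= dotprod (u y - c) (u y - c)) ->
  dotprod x x <= r -> 1 <= s -> r <= barrier u c x s.
Proof.
move=> n0 us usys init xr s1; rewrite leNgt; apply/negP => brl.
pose K := [set y : 'rV[R]_n | dotprod y y <= r] `*` `[1, s]%classic.
have Kxs : K (x, s) by split => //=; rewrite in_itv /= s1 lexx.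
have pos (t : R) : 1 <= t -> 0 < t by exact: lt_le_trans.
have [|[x0 s0]] := @compact_EVT_min _ R
    (fun z : 'rV[R]_n * R => barrier u c z.1 z.2) K (ex_intro _ _ Kxs)
    (compact_setX (@compact_euclidean_ball R n r) (@segment_compact R 1 s)).
  apply: continuous_in_subspaceT => -[y t] /set_mem [_ /=].
  rewrite in_itv /= => /andP[t1 _]; apply: barrier_continuous => //.
  by rewrite gt_eqF// pos.
move=> /set_mem [/= x0r]; rewrite in_itv /= => /andP[s01 s0s] Kmin.
have min y t : dotprod y y <= r -> 1 <= t <= s ->
    barrier u c x0 s0 <= barrier u c y t.
  by move=> yr t1; apply: (Kmin (y, t)); apply/mem_set; split.
have br : barrier u c x0 s0 < r by apply: le_lt_trans brl; apply: min; rewrite ?s1 ?lexx.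
have s0p : 0 < s0 by exact: pos.
have s0n : s0 != 0 by rewrite gt_eqF.
have nn : 0 < n%:R :> R by rewrite ltr0n.
have x0lt : dotprod x0 x0 < r.
  apply: le_lt_trans br; rewrite /barrier -addrA lerDl addr_ge0//.
    by apply: sumr_ge0 => a _; exact: sqr_ge0.
  have sV : s0^-1 <= 1 by rewrite invf_le1.
  apply: mulr_ge0; first by rewrite mulr_ge0.
  by rewrite subr_ge0 exprn_ile1// invr_ge0 ltW.
(* At [s = 1] the barrier is at least the vertical squared distance, which [init] bounds below by
   [r]. *)
have s0gt : 1 < s0.
  rewrite lt_neqAle s01 andbT; apply/eqP => s0E; move: br; rewrite ltNge => /negP; apply.
  rewrite -s0E /barrier invr1 expr1n subrr mulr0 addr0.
  have := init x0 x0r; move=> /le_trans; apply.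
  rewrite -[leLHS]add0r lerD ?dotprod_ge0// le_eqVlt; apply/orP; left; apply/eqP.
  by apply: eq_bigr => a _; rewrite scale1r mulr1 !mxE expr2.
have tmin t : 1 <= t <= s0 -> barrier u c x0 s0 <= barrier u c x0 t.
  by move=> /andP[t1 ts0]; apply: min => //; rewrite t1 (le_trans ts0).
have := left_min_derive_le0 (barrier_is_derive c x0 us s0n) s0gt tmin.
rewrite pmulr_rle0 ?divr_gt0 ?exprn_gt0// => time_le.
have : 0 <= n%:R + \sum_a (u (s0 *: x0) 0 a - (s0 *: c) 0 a) *
    (dotprod (s0 *: x0) (gradient (component u a) (s0 *: x0))
      - component u a (s0 *: x0)).
  apply: shrinker_spatial_min => // v.
  (* A displacement [t *: v] of [s0 *: x0] is a displacement of [x0] by [t *: (s0^-1 *: v)], which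
     stays in the open ball for small [t]. *)
  have : \forall t \near (0 : R), dotprod (x0 + t *: (s0^-1 *: v)) (x0 + t *: (s0^-1 *: v)) < r.
    have ct : (x0 + t *: (s0^-1 *: v)) @[t --> (0 : R)]
        --> x0 + (0 : R) *: (s0^-1 *: v).
      by apply: cvgD; [exact: cvg_cst|apply: cvgZr_tmp; exact: cvg_id].
    rewrite scale0r addr0 in ct.
    have := cvg_comp _ _ ct (@dotprod_self_continuous R n x0).
    by move=> /cvgr_lt; apply.
  move=> /nbhs_normP[e /= e0 He]; exists e => // t te.
  have xt := He t; rewrite /= sub0r normrN in xt.
  have := min _ s0 (ltW (xt te)); rewrite s01 s0s => /(_ isT).
  rewrite -(ler_pM2l (exprn_gt0 2 s0p)) !barrier_dist2_graph// lerD2r.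
  rewrite scalerDr; have -> // : s0 *: (t *: (s0^-1 *: v)) = t *: v.
  by rewrite !scalerA; congr (_ *: _); field.
under eq_bigr do rewrite mxE.
move: time_le; set Sg := \sum_a _ => A1 A2; lra.
Qed.

(** * The growth estimate *)

Lemma enorm_sqr (R : realType) (n : nat) (x : 'rV[R]_n) :
  enorm x ^+ 2 = dotprod x x.
Proof. by rewrite sqr_sqrtr// dotprod_ge0. Qed.

Lemma dotprodZ (R : realType) (n : nat) (k : R) (x : 'rV[R]_n) :
  dotprod (k *: x) (k *: x) = k ^+ 2 * dotprod x x.
Proof.
rewrite /dotprod mulr_sumr; apply: eq_bigr => i _; rewrite !mxE; ring.
Qed.

Lemma dotprod_le_sub (R : realType) (m : nat) (x y : 'rV[R]_m) :
  dotprod y y <= 2 * dotprod (x - y) (x - y) + 2 * dotprod x x.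
Proof.
rewrite /dotprod !mulr_sumr -big_split /=; apply: ler_sum => i _.
(* Coordinatewise, $2(x-y)^2+2x^2-y^2=(2x-y)^2$. *)
rewrite !mxE -subr_ge0; have := sqr_ge0 (2 * x 0 i - y 0 i).
by congr (_ <= _); ring.
Qed.

(** If the bound failed, the sphere centred at the height of the rescaled graph over [x] would start
    away from the graph, yet at [(x, s)] the vertical term vanishes and the barrier is at most
    $|x|^2+2n<r$. *)
Lemma shrinker_growth (R : realType) (n m : nat) (u : 'rV[R]_n -> 'rV[R]_m)
    (r S : R) (x : 'rV[R]_n) (s : R) :
  (0 < n)%N -> smooth_map u -> self_shrinking_system u ->
  (forall y, dotprod y y <= r -> dotprod (u y) (u y) <= S) ->
  dotprod x x + 2 * n%:R < r -> 1 <= s ->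
  dotprod (u (s *: x)) (u (s *: x)) <= 2 * s ^+ 2 * (S + r).
Proof.
move=> n0 us usys uS xr s1; rewrite leNgt; apply/negP => ularge.
have sp : 0 < s by exact: lt_le_trans s1.
have nn : 0 < n%:R :> R by rewrite ltr0n.
set c := s^-1 *: u (s *: x).
have cl : 2 * (S + r) <= dotprod c c.
  rewrite /c dotprodZ exprVn [leRHS]mulrC ler_pdivlMr ?exprn_gt0//.
  by rewrite mulrAC ltW.
have init y : dotprod y y <= r -> r <= dotprod (u y - c) (u y - c).
  by move=> /uS uyS; have := dotprod_le_sub (u y) c; lra.
have xler : dotprod x x <= r by lra.
have := shrinker_avoids_sphere n0 us usys init xler s1.
apply/negP; rewrite -ltNge /barrier big1 ?addr0.
  apply: le_lt_trans xr; rewrite lerD2l mulrBr mulr1 gerBl.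
  by rewrite mulr_ge0 ?sqr_ge0// mulr_ge0.
by move=> a _; rewrite /c mxE /component mulrC subrr expr0n.
Qed.

Theorem theorem2 (R : realType) (n m : nat) (hn : (1 <= n)%N) (hm : (1 <= m)%N)
    (u : 'rV[R]_n -> 'rV[R]_m) (hu : smooth_map u)
    (hsys : self_shrinking_system u) :
  linear_growth u /\
  forall x : 'rV[R]_n,
    enorm (u x) ^+ 2 <=
      (2 * enorm x ^+ 2 / (3 * n%:R) + 1) *
      (sup [set enorm (u y) ^+ 2 | y in
              [set y : 'rV[R]_n | enorm y <= 2 * Num.sqrt (3 * n%:R)]]
       + 12 * n%:R).
Proof.
have n1 : 1 <= n%:R :> R by rewrite ler1n.
set S := sup _.
have sq0 : 0 <= Num.sqrt (3 * n%:R) :> R by exact: sqrtr_ge0.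
have sqE : Num.sqrt (3 * n%:R) ^+ 2 = 3 * n%:R :> R by rewrite sqr_sqrtr//; lra.
have ballE (y : 'rV[R]_n) :
    (enorm y <= 2 * Num.sqrt (3 * n%:R)) = (dotprod y y <= 12 * n%:R).
  rewrite -[LHS](@ler_sqr R) ?nnegrE ?sqrtr_ge0 ?mulr_ge0// enorm_sqr exprMn sqE.
  by congr (_ <= _); ring.
(* The supremum is a genuine upper bound because the set is the continuous image of a compact ball,
   hence bounded. *)
have uS y : dotprod y y <= 12 * n%:R -> dotprod (u y) (u y) <= S.
  move=> yr; apply: ub_le_sup; last by exists y; rewrite /= ?ballE ?enorm_sqr.
  have -> : [set y : 'rV[R]_n | enorm y <= 2 * Num.sqrt (3 * n%:R)]
      = [set y | dotprod y y <= 12 * n%:R] by apply/funext => z /=; rewrite ballE.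
  apply: (proj2 (compact_has_sup _ _)).
    by exists (enorm (u y) ^+ 2), y.
  apply: continuous_compact; last exact: compact_euclidean_ball.
  apply: continuous_subspaceT => z.
  under eq_fun do rewrite enorm_sqr.
  rewrite /continuous_at /dotprod; apply: (@cvg_bigsum _ _ (nbhs z)) => a.
  have ca : u t 0 a @[t --> nbhs z] --> u z 0 a.
    by have [+ _] := hu a [::]; apply.
  by apply: (@cvgM _ _ (nbhs z)).
have S0 : 0 <= S.
  apply: le_trans (dotprod_ge0 (u 0)) _; apply: uS.
  rewrite /dotprod big1; first by rewrite mulr_ge0.
  by move=> i _; rewrite mxE mul0r.
have bound (x : 'rV[R]_n) :
    enorm (u x) ^+ 2 <= (2 * enorm x ^+ 2 / (3 * n%:R) + 1) * (S + 12 * n%:R).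
  rewrite !enorm_sqr.
  have q0 : 0 <= 2 * dotprod x x / (3 * n%:R).
    by rewrite divr_ge0 ?mulr_ge0 ?dotprod_ge0.
  (* Inside the ball the supremum suffices, the first factor being at least [1]. *)
  have [xr|xr] := leP (dotprod x x) (12 * n%:R).
    by apply: (le_trans (uS x xr)); nra.
  (* This scale puts [s^-1 *: x] at squared length [3 n], where $3n+2n<12n$; outside the ball it
     exceeds [1]. *)
  pose s := Num.sqrt (dotprod x x / (3 * n%:R)).
  have s2 : s ^+ 2 = dotprod x x / (3 * n%:R).
    by rewrite sqr_sqrtr// divr_ge0 ?dotprod_ge0// mulr_ge0.
  have s1 : 1 <= s.
    rewrite -(@ler_sqr R) ?nnegrE ?sqrtr_ge0// expr1n s2.
    by rewrite ler_pdivlMr ?mul1r; lra.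
  have sn : s != 0 by rewrite gt_eqF// (lt_le_trans _ s1).
  have xx0 : dotprod x x != 0 by rewrite gt_eqF//; lra.
  have yE : dotprod (s^-1 *: x) (s^-1 *: x) = 3 * n%:R.
    rewrite dotprodZ exprVn s2 invf_div divfK//.
  have := @shrinker_growth R n m u (12 * n%:R) S (s^-1 *: x) s hn hu hsys uS.
  rewrite yE scalerA mulfV// scale1r => /(_ _ s1) H.
  apply: (le_trans (H _)); first by lra.
  by rewrite s2 mulrA; nra.
split => //.
(* As $2/(3n)\leq 1$, the first factor is at most $|x|^2+1\leq(1+|x|)^2$. *)
exists (Num.sqrt (S + 12 * n%:R)) => x.
have C0 : 0 <= S + 12 * n%:R by lra.
have x0 : 0 <= enorm x by exact: sqrtr_ge0.
rewrite -(@ler_sqr R) ?nnegrE ?sqrtr_ge0//; last by rewrite mulr_ge0 ?sqrtr_ge0//; lra.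
rewrite exprMn [X in X * _]sqr_sqrtr//; apply: (le_trans (bound x)); rewrite mulrC.
apply: ler_wpM2l => //.
have : 2 * enorm x ^+ 2 / (3 * n%:R) <= enorm x ^+ 2.
  by rewrite ler_pdivrMr; [nra|lra].
nra.
Qed.
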